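(* Let $\psi$ be a 3-CNF formula and let $G_\psi$ be the signed digraph constructed from it as described in the context. The following are equivalent: 1. $\psi$ is not satisfiable; 2. every Boolean network on $G_\psi$ has at most one fixed point; 3. there is a word of length $12n+12m+11$ which synchronizes every Boolean network on $G_\psi$; 4. every Boolean network on $G_\psi$ is synchronizing.
   Context: $\psi$ is a 3-CNF formula over variables $\lambda_1,\dots,\lambda_n$ ($n\ge 2$) with clauses $\mu_1,\dots,\mu_m$ ($m\ge1$). Each variable $\lambda_r$ has a positive literal $\lambda_r^+$ and a negative literal $\lambda_r^-$; each clause is a set of three literals, written $\mu_s=\{\mu_{s,1},\mu_{s,2},\mu_{s,3}\}$ in a fixed order. An assignment $z\in\{0,1\}^n$ satisfies $\lambda_r^+$ if $z_r=1$ and $\lambda_r^-$ if $z_r=0$; $\psi$ is satisfiable if some $z$ satisfies a literal in every clause. $H_\psi$ is the signed digraph with vertices: all literals $\lambda_r^\pm$, $\ell_0,\dots,\ell_n$, $\mu'_1,\dots,\mu'_m$, $\mu_1,\dots,\mu_m$, $c_1,\dots,c_m$; arcs, for $r\in[n]$, $s\in[m]$: $(\ell_{r-1},\lambda_r^+),(\ell_{r-1},\lambda_r^-),(\lambda_r^+,\ell_r),(\lambda_r^-,\ell_r)$, $(c_1,\ell_0)$, $(\mu_{s,1},\mu'_s),(\mu_{s,2},\mu'_s),(\mu_{s,3},\mu_s),(\mu'_s,\mu_s)$ (here $\mu_{s,k}$ denotes the literal vertex), $(\mu_s,c_s)$, and $(c_{s+1},c_s)$ where $c_{m+1}$ means $\ell_n$.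 The arcs $(\mu_s,c_s)$ are negative, all others positive. $G_\psi$ is obtained from $H_\psi$ by adding two new vertices $q,t$, a negative arc $(\ell_0,q)$, positive arcs $(\ell_0,t),(q,t)$, and a positive arc $(t,i)$ for every literal vertex $i$. A signed digraph is $(V,E)$ with $E\subseteq V\times V\times\{-1,1\}$. A Boolean network (BN) is $f:\{0,1\}^V\to\{0,1\}^V$; its signed interaction digraph has a positive (negative) arc from $j$ to $i$ iff for some $x$ with $x_j=0$, $f_i(x+e_j)-f_i(x)$ is positive (negative); a BN on $G$ is one whose signed interaction digraph is $G$. A fixed point is $x$ with $f(x)=x$. $f^i(x)$ is $x$ with $x_i$ replaced by $f_i(x)$; $f^{i_1\cdots i_\ell}=f^{i_\ell}\circ\cdots\circ f^{i_1}$; $w$ synchronizes $f$ if $f^w$ is constant; $f$ is synchronizing if some word synchronizes it. *)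

(* Defs.v *)
From HB Require Import structures.
From mathcomp Require Import all_boot.
Set Implicit Arguments. Unset Strict Implicit. Unset Printing Implicit Defensive.

(* Literals over variables 'I_n : (r, true) = lambda_r^+, (r, false) = lambda_r^-.
   Variables and clauses are 0-indexed: variable r : 'I_n is lambda_{r+1},
   clause s : 'I_m is mu_{s+1}. *)
Definition literal (n : nat) := ('I_n * bool)%type.

(* A 3-CNF formula with n variables and m clauses: clause s has the three
   literals cl s k0, cl s k1, cl s k2 (in this fixed order). *)
Definition k0 : 'I_3 := @Ordinal 3 0 isT.
Definition k1 : 'I_3 := @Ordinal 3 1 isT.
Definition k2 : 'I_3 := @Ordinal 3 2 isT.

Definition lit_sat n (z : 'I_n -> bool) (l : literal n) : bool := z l.1 == l.2.

Definition satisfiable n m (cl : 'I_m -> 'I_3 -> literal n) : Prop :=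
  exists z : 'I_n -> bool, forall s : 'I_m, exists k : 'I_3, lit_sat z (cl s k).

(* Vertices of G_psi. Ell a = ell_a (a = 0..n), MuP s = mu'_{s+1},
   Mu s = mu_{s+1}, C s = c_{s+1}. *)
Inductive vert (n m : nat) :=
| Lit of literal n
| Ell of 'I_n.+1
| MuP of 'I_m
| Mu of 'I_m
| C of 'I_m
| Q
| T.
Arguments Lit {n m}. Arguments Ell {n m}. Arguments MuP {n m}.
Arguments Mu {n m}. Arguments C {n m}. Arguments Q {n m}. Arguments T {n m}.

Section VertFin.
Variables n m : nat.
Definition vcode_t := (literal n + ('I_n.+1 + ('I_m + ('I_m + ('I_m + bool)))))%type.
Definition vcode (v : vert n m) : vcode_t :=
  match v with
  | Lit l => inl l
  | Ell a => inr (inl a)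
  | MuP s => inr (inr (inl s))
  | Mu s => inr (inr (inr (inl s)))
  | C s => inr (inr (inr (inr (inl s))))
  | Q => inr (inr (inr (inr (inr true))))
  | T => inr (inr (inr (inr (inr false))))
  end.
Definition vdecode (c : vcode_t) : vert n m :=
  match c with
  | inl l => Lit l
  | inr (inl a) => Ell a
  | inr (inr (inl s)) => MuP s
  | inr (inr (inr (inl s))) => Mu s
  | inr (inr (inr (inr (inl s)))) => C s
  | inr (inr (inr (inr (inr true)))) => Q
  | inr (inr (inr (inr (inr false)))) => T
  end.
Lemma vcodeK : cancel vcode vdecode. Proof. by case. Qed.
HB.instance Definition _ := Finite.copy (vert n m) (can_type vcodeK).
End VertFin.

(* Signed arcs of G_psi: Garc cl u v b holds iff (u, v, sign) is an arc,
   with b = true for a positive arc and b = false for a negative arc. *)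
Definition Garc n m (cl : 'I_m -> 'I_3 -> literal n) (u v : vert n m) (b : bool) : bool :=
  match u, v with
  | Ell a, Lit l => b && (nat_of_ord a == nat_of_ord l.1)
  | Lit l, Ell a => b && (nat_of_ord a == (nat_of_ord l.1).+1)
  | C s, Ell a => b && (nat_of_ord s == 0) && (nat_of_ord a == 0)
  | Lit l, MuP s => b && ((l == cl s k0) || (l == cl s k1))
  | Lit l, Mu s => b && (l == cl s k2)
  | MuP s, Mu s' => b && (s == s')
  | Mu s, C s' => ~~ b && (s == s')
  | C s, C s' => b && (nat_of_ord s == (nat_of_ord s').+1)
  (* (c_{m+1}, c_m) where c_{m+1} = ell_n *)
  | Ell a, C s => b && (nat_of_ord a == n) && ((nat_of_ord s).+1 == m)
  | Ell a, Q => ~~ b && (nat_of_ord a == 0)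
  | Ell a, T => b && (nat_of_ord a == 0)
  | Q, T => b
  | T, Lit _ => b
  | _, _ => false
  end.

Definition config (V : finType) := {ffun V -> bool}.
Definition BN (V : finType) := config V -> config V.

Definition upd (V : finType) (x : config V) (j : V) (b : bool) : config V :=
  [ffun k => if k == j then b else x k].

Definition interaction_arc (V : finType) (f : BN V) (j i : V) (b : bool) : Prop :=
  exists x : config V, x j = false /\
    (if b then (f x i == false) && (f (upd x j true) i == true)
          else (f x i == true) && (f (upd x j true) i == false)).

Definition BN_on (V : finType) (E : V -> V -> bool -> bool) (f : BN V) : Prop :=
  forall (j i : V) (b : bool), interaction_arc f j i b <-> E j i b.

Definition is_fixed (V : finType) (f : BN V) (x : config V) : Prop := f x = x.

Definition async (V : finType) (f : BN V) (i : V) (x : config V) : config V :=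
  upd x i (f x i).

Definition async_word (V : finType) (f : BN V) (w : seq V) (x : config V) : config V :=
  foldl (fun y i => async f i y) x w.

Definition synchronizes (V : finType) (w : seq V) (f : BN V) : Prop :=
  forall x y : config V, async_word f w x = async_word f w y.

Definition synchronizing (V : finType) (f : BN V) : Prop :=
  exists w : seq V, synchronizes w f.

(* Main.v *)
Require Import Defs.
From mathcomp Require Import all_boot zify.
Set Implicit Arguments. Unset Strict Implicit. Unset Printing Implicit Defensive.

(* Every vertex of G_psi has one or two inputs, so a network on G_psi is a choice of AND or OR
   at each vertex.

   Uniqueness of fixed points (psi unsatisfiable).  At a fixed point Q is the negation of Ell 0,
   so T has a value tau that depends only on its gate.  Two distinct fixed points differ at
   Ell 0; let p be the one with value tau there and p' the other.  In p all literals, hence all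
   Mu s, have value tau.  Going along the clauses, C s differs in p and p' only if Mu s has
   value tau in p' and C (s+1) differs; so Ell n is ~~ tau in p', which forces, going back along
   the variables, that in p' the two literals of a variable never both have value tau.
   The literals with value tau in p' then define a satisfying assignment.

   Conversely a satisfying assignment gives two fixed points: T = OR, a literal is OR exactly
   when it is satisfied, Ell = AND and all the clause vertices are OR.

   Synchronization.  A sweep updates all vertices but Ell 0, Q, T in topological order.  Once T
   has value tau, the value of C 0 after a sweep is a function G of b = Ell 0, and G is not the
   identity since the fixed points of G yield fixed points of the network.  If G is constant, two
   sweeps synchronize.  If G is the negation, leaving Q stale after Ell 0 flips makes T copy
   Ell 0; flipping Ell 0 again gives T = ~~ Ell 0, so that the literals of the first variable
   are gates of two opposite inputs, hence constant; after T is reset to tau, so is everything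
   else. *)

(** * AND/OR gates with signed inputs *)

Definition gate (o : bool) (bs : seq bool) : bool :=
  if o then has id bs else all id bs.

Definition signed_values (V : finType) (l : seq (V * bool)) (x : config V) : seq bool :=
  [seq x p.1 == p.2 | p <- l].

Section Gates.
Variable V : finType.
Implicit Types (f : BN V) (x y : config V) (i j : V) (l : seq (V * bool)).

Lemma upd_eq x i b : upd x i b i = b.
Proof. by rewrite ffunE eqxx. Qed.

Lemma upd_neq x i b j : j != i -> upd x i b j = x j.
Proof. by rewrite ffunE => /negbTE ->. Qed.

Lemma upd_id x i : upd x i (x i) = x.
Proof. by apply/ffunP => k; rewrite ffunE; case: eqP => [->|]. Qed.

Lemma updK x i b c : upd (upd x i b) i c = upd x i c.
Proof. by apply/ffunP => k; rewrite !ffunE; case: eqP. Qed.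

Lemma no_arc_upd f i j x b :
  (forall s, ~ interaction_arc f j i s) -> f (upd x j b) i = f x i.
Proof.
move=> noarc; have H : f (upd x j true) i = f (upd x j false) i.
  case E1: (f (upd x j true) i); case E0: (f (upd x j false) i) => //.
    by case: (noarc true); exists (upd x j false); rewrite upd_eq updK E0 E1.
  by case: (noarc false); exists (upd x j false); rewrite upd_eq updK E0 E1.
by rewrite -{2}(upd_id x j); case: b (x j) => [] [].
Qed.

(** Pass from [x] to [y] one coordinate at a time along [enum V]; a coordinate that really changes
    has no arc to [i]. *)
Lemma eq_inputs f i x y :
  (forall j, x j != y j -> forall s, ~ interaction_arc f j i s) -> f x i = f y i.
Proof.
move=> H.
suff gen : forall s : seq V, f [ffun k => if k \in s then y k else x k] i = f x i.
  by rewrite -(gen (enum V)); congr (f _ i); apply/ffunP => k; rewrite ffunE mem_enum.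
elim=> [|k s IH]; first by congr (f _ i); apply/ffunP => k; rewrite ffunE.
rewrite -IH; set z := [ffun k => _] in IH *.
have -> : [ffun k0 => if k0 \in k :: s then y k0 else x k0] = upd z k (y k).
  by apply/ffunP => u; rewrite !ffunE inE; case: eqP => [->|].
have [e|ne] := eqVneq (x k) (y k); last by apply: no_arc_upd; apply: H.
have -> : y k = z k by rewrite ffunE e; case: ifP.
by rewrite upd_id.
Qed.

Lemma interaction_arcW f i j s x :
  f (upd x j (~~ s)) i = false -> f (upd x j s) i = true -> interaction_arc f j i s.
Proof.
by move=> E0 E1; exists (upd x j false); rewrite upd_eq updK;
  case: s E0 E1 => /= -> ->.
Qed.

Lemma interaction_arcP f i j s : interaction_arc f j i s ->
  exists x, f (upd x j (~~ s)) i = false /\ f (upd x j s) i = true.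
Proof.
case=> x [xj H]; exists x.
have xE : upd x j false = x by rewrite -xj upd_id.
by case: s H => /andP [/eqP E0 /eqP E1]; rewrite /= xE.
Qed.

Lemma gate_mono o l x y :
  (forall p, p \in l -> x p.1 == p.2 -> y p.1 == p.2) ->
  gate o (signed_values l x) -> gate o (signed_values l y).
Proof.
rewrite /gate /signed_values => H; case: o.
  by rewrite !has_map => /hasP [p pl /= xp]; apply/hasP; exists p => //; apply: H.
by rewrite !all_map => /allP Hx; apply/allP => p pl /=; apply: H => //; apply: Hx.
Qed.

(** Gates are monotone in their signed inputs, which excludes any other arc. As no vertex is listed
    with both signs, all inputs but one can be made neutral at once, which exhibits each listed
    arc. *)
Lemma interaction_arc_gate f i o l :
  uniq (unzip1 l) -> (forall x, f x i = gate o (signed_values l x)) ->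
  forall j s, interaction_arc f j i s <-> (j, s) \in l.
Proof.
move=> ul fE j s; split.
  case/interaction_arcP=> x; rewrite !fE => -[E0 E1].
  apply: contraFT E0 => jl; apply: gate_mono E1 => -[k c] kl /=.
  have [ek|kj] := eqVneq k j; last by rewrite !upd_neq.
  by rewrite ek upd_eq => /eqP sc; case/negP: jl; rewrite sc -ek.
move=> jl.
have only k (a b : bool) : (k, a) \in l -> (k, b) \in l -> a = b.
  elim: l ul {fE jl} => //= -[k' c] l IH /= /andP [kl ul].
  have nin d : (k', d) \in l -> False by move=> kd; case/negP: kl; exact: (map_f fst kd).
  rewrite !inE !xpair_eqE; case: (eqVneq k k') => [->|_] /=; last exact: IH.
  by case/orP=> [/eqP ->|/nin //] /orP [/eqP ->|/nin //].
(* All the other inputs are set to the neutral value of the gate. *)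
pose x : config V := [ffun k => (k, ~~ o) \in l].
have xE k (a : bool) : (k, a) \in l -> (x k == a) = ~~ o.
  rewrite ffunE; case: (boolP ((k, ~~ o) \in l)) => [h1 h2|h1 h2].
    by rewrite -(only _ _ _ h1 h2); case: (o).
  by case: a h2 h1; case: (o) => // ->.
have val b k (a : bool) : (k, a) \in l -> (upd x j b k == a) = if k == j then b == s else ~~ o.
  move=> kl; case: (k =P j) => [ek|/eqP kj].
    by rewrite ek upd_eq; rewrite ek in kl; rewrite (only _ _ _ kl jl).
  by rewrite upd_neq // xE.
apply: (@interaction_arcW _ _ _ _ x); rewrite fE /gate /signed_values.
  case: (o) val => val.
    rewrite has_map; apply/hasP => -[[k a] kl /=]; rewrite val //.
    by case: (k == j) => //; case: (s).
  rewrite all_map; apply/negP => /allP /(_ _ jl) /=; rewrite val // eqxx.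
  by case: (s).
case: (o) val => val.
  by rewrite has_map; apply/hasP; exists (j, s) => //=; rewrite val ?eqxx.
rewrite all_map; apply/allP => -[k a] kl /=; rewrite val //; case: (k == j) => //.
Qed.

(** The arcs make [f x i] monotone in its signed inputs and dependent on each of them; with at most
    two inputs only AND and OR remain. *)
Lemma gate_of_interaction_arc f i l :
  0 < size l <= 2 -> uniq (unzip1 l) ->
  (forall j s, interaction_arc f j i s <-> (j, s) \in l) ->
  exists o, forall x, f x i = gate o (signed_values l x).
Proof.
case: l => [//|[j a] [|[k b] []]] //= _.
  move=> _ H; pose h p := f (upd [ffun=> false] j p) i.
  have fE x : f x i = h (x j).
    apply: eq_inputs => u; rewrite !ffunE; case: (u =P j) => [->|/eqP uj _ s].
      by rewrite eqxx.
    by move/H; rewrite inE xpair_eqE (negbTE uj).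
  have hE : h (~~ a) = false /\ h a = true.
    have /interaction_arcP [x] : interaction_arc f j i a by apply/H; rewrite inE.
    by rewrite !fE !upd_eq.
  by exists true => x; rewrite fE /= orbF; case: (x j) (a) hE => [] [] [].
rewrite inE andbT => jk H.
pose h p q := f (upd (upd [ffun=> false] j p) k q) i.
have fE x : f x i = h (x j) (x k).
  apply: eq_inputs => u; rewrite !ffunE; case: (u =P k) => [->|/eqP uk].
    by rewrite eqxx.
  case: (u =P j) => [->|/eqP uj _ s]; first by rewrite eqxx.
  by move/H; rewrite !inE !xpair_eqE (negbTE uj) (negbTE uk).
have kj : k != j by rewrite eq_sym.
have [q1 [E1 E1']] : exists q, h (~~ a) q = false /\ h a q = true.
  have /interaction_arcP [x] : interaction_arc f j i a by apply/H; rewrite inE eqxx.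
  by rewrite !fE !upd_eq !upd_neq //; exists (x k).
have [p1 [E2 E2']] : exists p, h p (~~ b) = false /\ h p b = true.
  have /interaction_arcP [x] : interaction_arc f k i b by apply/H; rewrite !inE eqxx orbT.
  by rewrite !fE !upd_eq !upd_neq //; exists (x j).
have N1 q : ~ (h (~~ a) q = true /\ h a q = false).
  move=> [h1 h2]; have : interaction_arc f j i (~~ a).
    apply: (@interaction_arcW _ _ _ _ (upd [ffun=> false] k q));
      by rewrite ?negbK fE upd_eq upd_neq // upd_eq.
  by move/H; rewrite !inE !xpair_eqE (negbTE jk) eqxx /= orbF; case: (a).
have N2 p : ~ (h p (~~ b) = true /\ h p b = false).
  move=> [h1 h2]; have : interaction_arc f k i (~~ b).
    apply: (@interaction_arcW _ _ _ _ (upd [ffun=> false] j p));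
      by rewrite ?negbK fE upd_eq upd_neq // upd_eq.
  by move/H; rewrite !inE !xpair_eqE (negbTE kj) eqxx /=; case: (b).
(* One active and one inactive input tell OR from AND. *)
exists (h a (~~ b)) => x; rewrite fE /gate /=.
have n1 := N1 true; have n2 := N1 false; have n3 := N2 true; have n4 := N2 false.
move: E1 E1' E2 E2' n1 n2 n3 n4; clear; move: q1 p1.
by case: a; case: b; case: (x j); case: (x k) => -[] [] /=;
  case: (h true true); case: (h true false); case: (h false true); case: (h false false);
  intuition congruence.
Qed.
End Gates.

(** * Updating vertices in topological order *)

Section Sweeps.
Variables (V : finType) (f : BN V) (inputs : V -> seq V) (rank : V -> nat).
Hypothesis f_local : forall i (x y : config V), {in inputs i, x =1 y} -> f x i = f y i.
Implicit Types (x y : config V) (w : seq V).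

Lemma async_word_cat w1 w2 x :
  async_word f (w1 ++ w2) x = async_word f w2 (async_word f w1 x).
Proof. exact: foldl_cat. Qed.

Lemma async_word_notin w x v : v \notin w -> async_word f w x v = x v.
Proof.
elim: w x => //= i w IH x; rewrite inE negb_or => /andP [vi vw].
by rewrite IH // /async upd_neq.
Qed.

Lemma sorted_rank_cons v w : sorted (relpre rank leq) (v :: w) ->
  {in w, forall u, rank v <= rank u} /\ sorted (relpre rank leq) w.
Proof.
rewrite /= path_sortedE; last by move=> ? ? ?; apply: leq_trans.
by case/andP=> /allP.
Qed.

(** [A] collects the vertices where both runs are known to agree. Ranks never decrease along [w], so
    the inputs of its head already lie in [A] and the head can join them. *)
Lemma sweep_agree (A : pred V) w x y : sorted (relpre rank leq) w ->
  (forall v u, v \in w -> u \in inputs v -> A u \/ u \in w /\ rank u < rank v) ->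
  (forall u, A u -> x u = y u) ->
  forall u, A u || (u \in w) -> async_word f w x u = async_word f w y u.
Proof.
elim: w A x y => [|v w IH] A x y sw inw Axy u; first by rewrite orbF; apply: Axy.
have [vmin sw'] := sorted_rank_cons sw.
have fv : f x v = f y v.
  apply: f_local => t tv; apply: Axy.
  have [//|[tw]] := inw v t (mem_head _ _) tv.
  move: tw; rewrite inE => /orP [/eqP ->|/vmin]; first by rewrite ltnn.
  by rewrite leqNgt => /negbTE ->.
move=> Au; apply: (IH (predU1 v A)) => //=.
- move=> v' t vw /(inw v') []; first by rewrite inE vw orbT.
    by move=> At; left; rewrite At orbT.
  by rewrite inE => -[/orP [->|tw] lt]; [left | right].
- move=> t; rewrite /async /upd !ffunE fv; case: eqP => //= _; exact: Axy.
by move: Au; rewrite inE orbCA orbA.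
Qed.

(** No input of [v] is updated at or after [v], so the value computed for [v] stays correct. *)
Lemma sweep_fixed w x : sorted (relpre rank leq) w -> uniq w ->
  (forall v u, v \in w -> u \in inputs v -> rank u < rank v) ->
  {in w, f (async_word f w x) =1 async_word f w x}.
Proof.
elim: w x => // v w IH x sw /= /andP [vw uw] inw t.
have [vmin sw'] := sorted_rank_cons sw.
rewrite inE => /orP [/eqP ->|tw]; last first.
  by apply: IH => // v' u v'w; apply: inw; rewrite inE v'w orbT.
rewrite (async_word_notin _ vw) /async upd_eq; apply: f_local => u uv.
have lt := inw v u (mem_head _ _) uv.
rewrite async_word_notin ?upd_neq //.
  by apply: contraTneq lt => ->; rewrite ltnn.
by apply: contraTN lt => /vmin; rewrite -leqNgt.
Qed.

End Sweeps.

(** * The graph described by in-neighbours *)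

Section Inputs.
Variables (n m : nat) (cl : 'I_m.+1 -> 'I_3 -> literal n.+1).
Local Notation vertex := (vert n.+1 m.+1).
Implicit Types (x y : config vertex) (v : vertex).

(** [unlift ord_max s] is [None] exactly at the last clause, where the convention that c_{m+1} is
    ell_n applies. *)
Definition next_clause (s : 'I_m.+1) : vertex :=
  if unlift ord_max s is Some s' then C (lift ord0 s') else Ell ord_max.

(** [lift ord_max r] keeps the value of [r] and indexes the [Ell] before its literals; [lift ord0 r]
    adds one and indexes the [Ell] after them. *)
Definition inputs (v : vertex) : seq (vertex * bool) :=
  match v with
  | Lit l => [:: (Ell (lift ord_max l.1), true); (T, true)]
  | Ell a => if unlift ord0 a is Some r
             then [:: (Lit (r, true), true); (Lit (r, false), true)]
             else [:: (C ord0, true)]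
  | MuP s => [:: (Lit (cl s k0), true); (Lit (cl s k1), true)]
  | Mu s => [:: (Lit (cl s k2), true); (MuP s, true)]
  | C s => [:: (Mu s, false); (next_clause s, true)]
  | Q => [:: (Ell ord0, false)]
  | T => [:: (Ell ord0, true); (Q, true)]
  end.

Lemma vertex_eqE :
  ((forall l l', (Lit l == Lit l' :> vertex) = (l == l')) *
   (forall a a', (Ell a == Ell a' :> vertex) = (a == a')) *
   (forall s s', (MuP s == MuP s' :> vertex) = (s == s')) *
   (forall s s', (Mu s == Mu s' :> vertex) = (s == s')) *
   (forall s s', (C s == C s' :> vertex) = (s == s')))%type.
Proof. by (do 4?split) => u v; apply/eqP/eqP => [[]|->]. Qed.

Lemma Garc_inputs u v b : Garc cl u v b = ((u, b) \in inputs v).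
Proof.
have bT : (b == true) = b by case: b.
have lm (a : 'I_n.+2) (r : 'I_n.+1) : (a == lift ord_max r) = (nat_of_ord a == r).
  by rewrite -[LHS]val_eqE [val (lift _ _)]lift_max.
have bF : (b == false) = ~~ b by case: (b).
have nx (s : 'I_m.+1) w : (w == next_clause s) =
    match w with
    | C s' => nat_of_ord s' == s.+1
    | Ell a => (nat_of_ord a == n.+1) && (s.+1 == m.+1)
    | _ => false
    end.
  rewrite /next_clause; case: unliftP => [s' ->|->]; rewrite ?lift_max;
    case: w => [l|a|r|r|r||] //=.
  - by rewrite eqSS (ltn_eqF (ltn_ord s')) andbF.
  - by rewrite vertex_eqE -val_eqE /= eqxx andbT.
  - by rewrite (ltn_eqF (ltn_ord r)).
case: v => [l|a|s|s|s||] /=.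
- case: u => [l'|a|s|s|s||] //=; rewrite !inE !xpair_eqE /= ?vertex_eqE ?bT ?eqxx ?orbF //.
  by rewrite lm andbC.
- case: unliftP => [r ->|->]; case: u => [[r' c]|a'|s|s|s||] //=;
    rewrite !inE !xpair_eqE /= ?vertex_eqE ?xpair_eqE ?bT ?eqxx ?orbF ?andbF //=.
  + rewrite /bump leq0n add1n eqSS eq_sym -[r' == r]val_eqE.
    by case: c => /=; rewrite ?andbT ?andbF ?orbF andbC.
  + by rewrite andbT andbC.
- case: u => [l'|a'|r|r|r||] //=; rewrite !inE !xpair_eqE /= ?vertex_eqE ?bT ?eqxx ?orbF ?andbF //=.
  by rewrite -andb_orl andbC.
- case: u => [l'|a'|r|r|r||] //=; rewrite !inE !xpair_eqE /= ?vertex_eqE ?bT ?eqxx ?orbF ?andbF //=.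
  + by rewrite andbC.
  + by rewrite andbC.
- case: u => [l'|a'|r|r|r||] //=;
    rewrite !inE !xpair_eqE nx /= ?vertex_eqE ?bT ?bF ?eqxx ?orbF ?andbF //=.
  + by rewrite [RHS]andbC andbA.
  + by rewrite andbC.
  + by rewrite andbC.
- case: u => [l'|a'|r|r|r||] //=; rewrite !inE !xpair_eqE /= ?vertex_eqE ?bF ?eqxx ?orbF ?andbF //=.
  by rewrite -val_eqE /= andbC.
- case: u => [l'|a'|r|r|r||] //=; rewrite !inE !xpair_eqE /= ?vertex_eqE ?bT ?eqxx ?orbF ?andbF //=.
  by rewrite -val_eqE /= andbC.
Qed.

Hypothesis cl_inj : forall s, injective (cl s).

(** Injectivity of [cl s] keeps the two literals feeding [MuP s] distinct. *)
Lemma inputs_wf v : 0 < size (inputs v) <= 2 /\ uniq (unzip1 (inputs v)).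
Proof.
case: v => [l|a|s|s|s||] //=.
- by case: unliftP => //= r _; rewrite inE vertex_eqE xpair_eqE andbF.
- by rewrite inE vertex_eqE (inj_eq (@cl_inj s)).
- by rewrite inE /next_clause; case: unlift.
Qed.

Lemma BN_on_GarcP (f : BN vertex) : BN_on (Garc cl) f <->
  forall v, exists o, forall x, f x v = gate o (signed_values (inputs v) x).
Proof.
split=> [Ef v | Ef j i s].
  have [sz ul] := inputs_wf v; apply: gate_of_interaction_arc => // j s.
  by rewrite -Garc_inputs; apply: Ef.
have [sz ul] := inputs_wf i; have [o fE] := Ef i.
by rewrite Garc_inputs; apply: interaction_arc_gate ul fE j s.
Qed.

(** * Two fixed points from a satisfying assignment *)

Lemma satisfiable_two_fixed_points : satisfiable cl ->
  exists f : BN vertex, BN_on (Garc cl) f /\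
    exists x y, [/\ is_fixed f x, is_fixed f y & x <> y].
Proof.
case=> z zP.
pose o v := match v with Ell _ => false | Lit l => lit_sat z l | _ => true end.
pose f : BN vertex := fun x => [ffun v => gate (o v) (signed_values (inputs v) x)].
(* In [fp a] the value [a] travels along all [Ell] and [C]; satisfied literals are true and the
   others copy [a]. *)
pose lit a l := lit_sat z l || a.
pose fp a : config vertex := [ffun v => match v with
  | Lit l => lit a l
  | MuP s => lit a (cl s k0) || lit a (cl s k1)
  | Ell _ | C _ => a
  | Q => ~~ a
  | Mu _ | T => true
  end].
exists f; split.
  by apply/BN_on_GarcP => v; exists (o v) => x; rewrite ffunE.
have fpP a : is_fixed f (fp a).
  apply/ffunP => v; rewrite [LHS]ffunE [RHS]ffunE /signed_values.
  case: v => [l|e|s|s|s||] /=; rewrite ?ffunE //=.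
  - by rewrite /gate /lit /=; case: lit_sat; case: (a).
  - case: unliftP => [r _|_]; rewrite /= ?ffunE //=; last by case: (a).
    by rewrite /lit /lit_sat /=; case: (z r); case: (a).
  - by rewrite !eqb_id orbF.
  (* A satisfied literal forces [Mu s] to be true; its negative arc then lets the OR at [C s]
     transmit [a]. *)
  - rewrite !eqb_id; have [k] := zP s; rewrite /lit.
    by case: k => -[|[|[|//]]] lk; rewrite (bool_irrelevance lk isT) => ->; rewrite ?orbT.
  - by rewrite /next_clause; case: unliftP => [s' _|_]; case: (a).
  - by case: (a).
  - by case: (a).
exists (fp true), (fp false); split=> //.
by move/ffunP/(_ (Ell ord0)); rewrite !ffunE.
Qed.

(** * The sweep word *)

Definition rank (v : vertex) : nat :=
  match v with
  | Q | T => 0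
  | Ell a => a.*2
  | Lit l => l.1.*2.+1
  | MuP _ => n.+1.*2.+1
  | Mu _ => n.+1.*2.+2
  | C s => n.+1.*2.+2 + (m.+1 - s)
  end.

(** Every cycle passes through [Ell ord0]. [Q] and [T] also stay out of the sweep, so that they can
    be left stale on purpose. *)
Definition drivers : seq vertex := [:: Ell ord0; Q; T].

(** Clause ranks lie above [n.+1.*2], the rank of the last [Ell]; those of [C] decrease in [s]
    because the chain runs from the last clause to the first. *)
Lemma rank_inputs v u :
  v \notin drivers -> u \in unzip1 (inputs v) -> rank u < rank v.
Proof.
rewrite !inE; case: v => [l|a|s|s|s||] //=.
- by rewrite !inE => _ /orP [] /eqP ->; rewrite /rank ?lift_max.
- rewrite vertex_eqE; case: unliftP => [r ->|-> //] _.
  by rewrite !inE => /orP [] /eqP -> /=; rewrite /bump leq0n add1n doubleS.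
- by rewrite !inE => _ /orP [] /eqP ->; rewrite /rank ltnS ltn_double ltn_ord.
- by rewrite !inE => _ /orP [] /eqP ->; rewrite /rank // ltnS leqW // ltn_double ltn_ord.
- rewrite !inE /next_clause => _ /orP [] /eqP -> /=.
    by rewrite -addn1 leq_add2l subn_gt0.
  case: unliftP => [s' ->|->]; rewrite /rank ?lift_max.
    by rewrite ltn_add2l [nat_of_ord (lift _ _)]lift0 subSS subSn // ltnW.
  by rewrite /= ltnW // !ltnS leq_addr.
Qed.

(** These two literals are the only swept vertices that read [Ell ord0]; cutting the sweep here
    allows [T] to be reset before the rest is updated. *)
Definition sweep_start : seq vertex :=
  [:: Lit (ord0, true); Lit (ord0, false); Ell (lift ord0 ord0)].

Definition sweep_rest : seq vertex :=
  sort (relpre rank leq) [seq v <- enum {: vertex} | v \notin drivers ++ sweep_start].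

Definition sweep : seq vertex := sweep_start ++ sweep_rest.

Lemma mem_sweep_rest v :
  (v \in sweep_rest) = (v \notin drivers) && (v \notin sweep_start).
Proof. by rewrite mem_sort mem_filter mem_enum andbT mem_cat negb_or. Qed.

Lemma mem_sweep v : (v \in sweep) = (v \notin drivers).
Proof.
rewrite mem_cat mem_sweep_rest; case: (boolP (v \in sweep_start)) => //=.
  by rewrite !inE => /or3P [] /eqP ->.
by rewrite andbT.
Qed.

Lemma sweep_rest_sorted : sorted (relpre rank leq) sweep_rest.
Proof. by apply: sort_sorted => u v; apply: leq_total. Qed.

Lemma sweep_sorted : sorted (relpre rank leq) sweep.
Proof.
have tr : transitive (relpre rank leq) by move=> ? ? ?; apply: leq_trans.
rewrite /sweep /= path_sortedE // sweep_rest_sorted andbT.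
apply/allP => v; rewrite mem_sweep_rest !inE !negb_or; case: v => [[r b]|a|s|s|s||] //=.
- rewrite !vertex_eqE !xpair_eqE; case: r => -[|r] ltr //=; case: b; rewrite ?andbF //.
- by rewrite vertex_eqE; case: a => -[|a].
Qed.

Lemma sweep_uniq : uniq sweep.
Proof.
rewrite cat_uniq sort_uniq filter_uniq ?enum_uniq // andbT; apply/andP; split.
  by [].
by apply/hasPn => v; rewrite mem_sweep_rest => /andP [].
Qed.

Lemma card_vertex : #|{: vertex}| = 3 * n.+1 + 3 * m.+1 + 3.
Proof.
have /bij_eq_card -> : bijective (@vcode n.+1 m.+1).
  by exists (@vdecode n.+1 m.+1); [exact: vcodeK | do 6?case].
rewrite !card_sum card_prod card_bool !card_ord; lia.
Qed.

Lemma size_sweep_rest : size sweep_rest = 3 * n.+1 + 3 * m.+1 - 3.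
Proof.
have /perm_size : perm_eq (drivers ++ sweep) (enum {: vertex}).
  apply: uniq_perm; rewrite ?enum_uniq //.
    rewrite cat_uniq sweep_uniq andbT; apply/andP; split; first by [].
    by apply/hasPn => v; rewrite mem_sweep.
  by move=> v; rewrite mem_cat mem_sweep mem_enum orbN.
rewrite -cardE card_vertex !size_cat /=; lia.
Qed.

(** Opposite inputs make the output independent of the configuration: this freezes [T], and later
    the literals of the first variable. *)
Lemma gate_contrary o (b c : bool) : c = ~~ b -> gate o [:: b; c] = o.
Proof. by case: o b => [] [] ->. Qed.

Lemma gate_same o (b : bool) : gate o [:: b; b] = b.
Proof. by case: o b => [] []. Qed.

Lemma gate_single o (b : bool) : gate o [:: b] = b.
Proof. by case: o b => [] []. Qed.

(** * Synchronization when fixed points are unique *)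

Section Network.
Variable f : BN vertex.
Hypothesis f_on : BN_on (Garc cl) f.

Lemma BN_on_local v x y : {in unzip1 (inputs v), x =1 y} -> f x v = f y v.
Proof.
have [o fE] := (BN_on_GarcP f).1 f_on v; rewrite !fE => xy.
congr gate; apply/eq_in_map => p pv; rewrite xy //; exact: map_f.
Qed.

Lemma next_Ell0 x : f x (Ell ord0) = x (C ord0).
Proof.
have [o ->] := (BN_on_GarcP f).1 f_on (Ell ord0).
by rewrite /= unlift_none gate_single eqb_id.
Qed.

Lemma next_Q x : f x Q = ~~ x (Ell ord0).
Proof.
have [o ->] := (BN_on_GarcP f).1 f_on Q.
by rewrite gate_single; case: (x _).
Qed.

(** [tau] is the gate of [T]. The first case has [Q] up to date, the second has [Q] stale. *)
Lemma next_T : exists tau, forall x,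
  (x Q = ~~ x (Ell ord0) -> f x T = tau) /\
  (x Q = x (Ell ord0) -> f x T = x (Ell ord0)).
Proof.
have [o fE] := (BN_on_GarcP f).1 f_on T; exists o => x.
rewrite fE /signed_values /= !eqb_id; split=> xQ; first exact: gate_contrary.
by rewrite xQ gate_same.
Qed.

Lemma next_Lit0 b : exists k, forall x,
  x T = ~~ x (Ell ord0) -> f x (Lit (ord0, b)) = k.
Proof.
have [o fE] := (BN_on_GarcP f).1 f_on (Lit (ord0, b)); exists o => x.
rewrite fE /signed_values /= !eqb_id.
by rewrite (_ : lift ord_max ord0 = ord0) => [|]; [exact: gate_contrary | exact: val_inj].
Qed.

Lemma driver_inputs v u : v \notin drivers -> u \in unzip1 (inputs v) -> u != Q.
Proof.
rewrite !inE; case: v => [l|a|s|s|s||] //=.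
- by rewrite !inE => _ /orP [] /eqP ->.
- by case: unliftP => [r _|_] _; rewrite !inE => /=; [case/orP|]; move/eqP ->.
- by rewrite !inE => _ /orP [] /eqP ->.
- by rewrite !inE => _ /orP [] /eqP ->.
- by rewrite !inE /next_clause => _ /orP [] /eqP -> //; case: unlift.
Qed.

Lemma sweep_rest_inputs v u :
  v \in sweep_rest -> u \in unzip1 (inputs v) -> u != Ell ord0.
Proof.
rewrite mem_sweep_rest !inE !negb_or; case: v => [[r b]|a|s|s|s||] //=; rewrite ?andbF //.
- rewrite !inE !vertex_eqE !xpair_eqE /= => H /orP [] /eqP -> //.
  rewrite vertex_eqE -val_eqE [val _]lift_max /=; case: r H => -[|//] i /=.
  by case: b.
- by case: unliftP => [r _|_] _; rewrite !inE => /=; [case/orP|]; move/eqP ->.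
- by rewrite !inE => _ /orP [] /eqP ->.
- by rewrite !inE => _ /orP [] /eqP ->.
- by rewrite !inE /next_clause => _ /orP [] /eqP -> //; case: unlift.
Qed.

Lemma async_sweep_driver x v :
  v \in drivers -> async_word f sweep x v = x v.
Proof. by move=> vd; rewrite async_word_notin // mem_sweep vd. Qed.

(** [Q] feeds [T] alone, so [Ell ord0] and [T] are the only vertices outside the sweep that it
    reads. *)
Lemma async_sweep_eq x y v :
  x (Ell ord0) = y (Ell ord0) -> x T = y T -> v != Q ->
  async_word f sweep x v = async_word f sweep y v.
Proof.
move=> e0 eT vQ.
apply: (sweep_agree BN_on_local (A := pred2 (Ell ord0) T) sweep_sorted).
- move=> w u; rewrite mem_sweep => wd uw.
  have := driver_inputs wd uw; have := rank_inputs wd uw.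
  rewrite mem_sweep !inE; case: (u =P Ell ord0) => [->|_]; first by left.
  case: (u =P T) => [->|_]; first by left.
  by move=> -> /negbTE ->; right.
- by move=> u /pred2P [] ->.
by rewrite mem_sweep !inE (negbTE vQ) /=; case: (v == Ell _); case: (v == T).
Qed.

Lemma async_sweep_rest_eq x y v :
  x T = y T -> {in sweep_start, x =1 y} -> v != Ell ord0 -> v != Q ->
  async_word f sweep_rest x v = async_word f sweep_rest y v.
Proof.
move=> eT estart v0 vQ.
have cover u : u != Ell ord0 -> u != Q -> [|| u == T, u \in sweep_start | u \in sweep_rest].
  move=> u0 uQ; rewrite mem_sweep_rest; case: (u \in sweep_start); first by rewrite orbT.
  by rewrite !inE (negbTE u0) (negbTE uQ) andbT; exact: orbN.
apply: (sweep_agree BN_on_local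
          (A := fun u => (u == T) || (u \in sweep_start)) sweep_rest_sorted).
- move=> w u wr uw; move: (wr); rewrite mem_sweep_rest => /andP [wd _].
  have := cover u (sweep_rest_inputs wr uw) (driver_inputs wd uw).
  by rewrite orbA => /orP []; [left | right; split=> //; exact: rank_inputs wd uw].
- by move=> u /orP [/eqP ->|/estart].
by rewrite -orbA cover.
Qed.

Lemma async_eq i x : async f i x i = f x i.
Proof. exact: upd_eq. Qed.

Lemma async_neq i x j : j != i -> async f i x j = x j.
Proof. exact: upd_neq. Qed.

(* The repeated final Q only pads the word to length 12 n + 12 m + 11. *)
Lemma sweep_synchronizing_word :
  (forall x y, is_fixed f x -> is_fixed f y -> x = y) ->
  synchronizes ([:: Q; T] ++ sweep ++ [:: Ell ord0; Q] ++ sweep ++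
    [:: Ell ord0] ++ sweep ++ [:: T; Ell ord0] ++ sweep_start ++ [:: T] ++
    sweep_rest ++ [:: Ell ord0; Q; Q]) f.
Proof.
move=> uniq_fixed; have [tau T_eq] := next_T.
pose z : vertex := Ell ord0.
(* Off the drivers any values would do, as the sweep overwrites them; [Q] is set so that the drivers
   are stable once [G b = b]. *)
pose start b : config vertex :=
  [ffun v => match v with Ell _ => b | Q => ~~ b | T => tau | _ => false end].
pose G b := async_word f sweep (start b) (C ord0).
have sweepC x : x T = tau -> async_word f sweep x (C ord0) = G (x z).
  by move=> xT; apply: async_sweep_eq => //; rewrite ffunE.
have fixedG b : G b = b -> is_fixed f (async_word f sweep (start b)).
  move=> Gb; have driver v : v \in drivers ->
    async_word f sweep (start b) v = start b v by apply: async_sweep_driver.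
  have z0 : async_word f sweep (start b) z = b by rewrite driver // ffunE.
  have q0 : async_word f sweep (start b) Q = ~~ b by rewrite driver // ffunE.
  apply/ffunP => v; case: (boolP (v \in drivers)) => [|vd].
    rewrite !inE => /or3P [] /eqP ->.
    - by rewrite next_Ell0 z0.
    - by rewrite next_Q z0 q0.
    - by rewrite (T_eq _).1 ?z0 // driver // ffunE.
  apply: (sweep_fixed BN_on_local _ sweep_sorted sweep_uniq); last by rewrite mem_sweep.
  by move=> w u; rewrite mem_sweep; exact: rank_inputs.
have G_not_id : ~ (G true = true /\ G false = false).
  case=> /fixedG f1 /fixedG f0; have /ffunP /(_ z) := uniq_fixed _ _ f1 f0.
  by rewrite !async_sweep_driver // !ffunE.
clearbody G.
(* [s1] to [s10] are the configurations after the successive blocks of the word, known only through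
   the facts recorded before each [clearbody]. *)
pose s1 x := async_word f [:: Q; T] x.
have s1cat w x : async_word f ([:: Q; T] ++ w) x = async_word f w (s1 x) by exact: async_word_cat.
have s1z x : s1 x z = x z by rewrite /s1 /= !async_neq.
have s1T x : s1 x T = tau.
  by rewrite /s1 /= async_eq; apply: (T_eq _).1; rewrite async_eq next_Q async_neq.
clearbody s1; pose s2 x := async_word f sweep (s1 x).
have s2cat w x : async_word f (sweep ++ w) (s1 x) = async_word f w (s2 x).
  by exact: async_word_cat.
have s2C x : s2 x (C ord0) = G (x z) by rewrite /s2 sweepC ?s1T ?s1z.
have s2T x : s2 x T = tau by rewrite /s2 async_sweep_driver.
clearbody s2; pose s3 x := async_word f [:: z; Q] (s2 x).
have s3cat w x : async_word f ([:: z; Q] ++ w) (s2 x) = async_word f w (s3 x).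
  by exact: async_word_cat.
have s3z x : s3 x z = G (x z) by rewrite /s3 /= async_neq // async_eq next_Ell0.
have s3Q x : s3 x Q = ~~ G (x z).
  by rewrite /s3 /= async_eq next_Q async_eq next_Ell0 s2C.
have s3T x : s3 x T = tau by rewrite /s3 /= !async_neq.
clearbody s3; pose s4 x := async_word f sweep (s3 x).
have s4cat w x : async_word f (sweep ++ w) (s3 x) = async_word f w (s4 x).
  by exact: async_word_cat.
have s4C x : s4 x (C ord0) = G (G (x z)) by rewrite /s4 sweepC ?s3T ?s3z.
have s4T x : s4 x T = tau by rewrite /s4 async_sweep_driver.
have s4Q x : s4 x Q = ~~ G (x z) by rewrite /s4 async_sweep_driver.
have s4eq x y v : G (x z) = G (y z) -> v != Q -> s4 x v = s4 y v.
  by move=> Gxy; apply: async_sweep_eq; rewrite ?s3T // !s3z.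
clearbody s4; move=> x y.
rewrite [LHS]s1cat [RHS]s1cat [LHS]s2cat [RHS]s2cat.
rewrite [LHS]s3cat [RHS]s3cat [LHS]s4cat [RHS]s4cat.
(* For constant [G], the value of [Ell ord0] before the second sweep is already independent of the
   start. *)
have [GE|Gne] := eqVneq (G true) (G false).
  have {}GE b c : G b = G c by case: b; case: c.
  suff -> : s4 x = s4 y by [].
  apply/ffunP => v.
  have [->|vQ] := eqVneq v Q; first by rewrite !s4Q (GE _ (y z)).
  by apply: s4eq => //; exact: GE.
have {Gne G_not_id}GE b : G b = ~~ b.
  by move: Gne G_not_id; case: b; case: (G true); case: (G false) => // _ [].
(* Two negations bring [Ell ord0] back to its initial value, while [Q] still holds the negation of
   the intermediate one. *)
pose s5 x := async_word f [:: z] (s4 x).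
have s5cat w u : async_word f ([:: z] ++ w) (s4 u) = async_word f w (s5 u).
  by exact: async_word_cat.
have s5z u : s5 u z = u z by rewrite /s5 /= async_eq next_Ell0 s4C !GE negbK.
have s5Q u : s5 u Q = u z by rewrite /s5 /= async_neq // s4Q GE negbK.
have s5T u : s5 u T = tau.
  by rewrite /s5 /= async_neq.
(* This sweep sets [C ord0] to the negation of [Ell ord0], ready for the next flip. *)
clearbody s5; pose s6 x := async_word f sweep (s5 x).
have s6cat w u : async_word f (sweep ++ w) (s5 u) = async_word f w (s6 u).
  by exact: async_word_cat.
have s6C u : s6 u (C ord0) = ~~ u z by rewrite /s6 sweepC ?s5T // s5z GE.
have s6z u : s6 u z = u z by rewrite /s6 async_sweep_driver.
have s6Q u : s6 u Q = u z by rewrite /s6 async_sweep_driver.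
(* Q is stale here, so that T copies the value of Ell ord0 before the latter flips. *)
clearbody s6; pose s7 x := async_word f [:: T; z] (s6 x).
have s7cat w u : async_word f ([:: T; z] ++ w) (s6 u) = async_word f w (s7 u).
  by exact: async_word_cat.
have s7z u : s7 u z = ~~ u z by rewrite /s7 /= async_eq next_Ell0 async_neq.
have s7Q u : s7 u Q = u z by rewrite /s7 /= !async_neq.
have s7T u : s7 u T = u z.
  by rewrite /s7 /= async_neq // async_eq (T_eq _).2 ?s6Q -/z ?s6z.
clearbody s7; pose s8 x := async_word f sweep_start (s7 x).
have s8cat w u : async_word f (sweep_start ++ w) (s7 u) = async_word f w (s8 u).
  by exact: async_word_cat.
have s8z u : s8 u z = ~~ u z by rewrite /s8 /= !async_neq.
have s8Q u : s8 u Q = u z by rewrite /s8 /= !async_neq.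
have [k1 k1E] := next_Lit0 true; have [k2 k2E] := next_Lit0 false.
have s8eq u w : {in sweep_start, s8 u =1 s8 w}.
  pose p t := async f (Lit (ord0, false)) (async f (Lit (ord0, true)) (s7 t)).
  have E1 t : p t (Lit (ord0, true)) = k1.
    by rewrite /p async_neq // async_eq; apply: k1E; rewrite s7T s7z negbK.
  have E2 t : p t (Lit (ord0, false)) = k2.
    by rewrite /p async_eq; apply: k2E; rewrite !async_neq // s7T s7z negbK.
  have s8E t : s8 t = async f (Ell (lift ord0 ord0)) (p t) by [].
  clearbody p; move=> v; rewrite !s8E !inE => /or3P [] /eqP ->.
  - by rewrite !async_neq // !E1.
  - by rewrite !async_neq // !E2.
  rewrite !async_eq; apply: BN_on_local => t /=.
  by rewrite liftK !inE => /orP [] /eqP ->; rewrite ?E1 ?E2.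
clearbody s8; pose s9 x := async_word f [:: T] (s8 x).
have s9cat w u : async_word f ([:: T] ++ w) (s8 u) = async_word f w (s9 u).
  by exact: async_word_cat.
(* The last flip of [Ell ord0] made the old value of [Q] correct again. *)
have s9T u : s9 u T = tau.
  by rewrite /s9 /= async_eq (T_eq _).1 // -/z s8z s8Q negbK.
have s9eq u w : {in sweep_start, s9 u =1 s9 w}.
  move=> v vs; rewrite /s9 /= !async_neq; first exact: s8eq.
    by move: vs; rewrite !inE => /or3P [] /eqP ->.
  by move: vs; rewrite !inE => /or3P [] /eqP ->.
clearbody s9; pose s10 x := async_word f sweep_rest (s9 x).
have s10cat w u : async_word f (sweep_rest ++ w) (s9 u) = async_word f w (s10 u).
  by exact: async_word_cat.
(* Only [Ell ord0] and [Q] may still differ; the final letters recompute them from [C ord0]. *)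
have s10eq u w v : v != z -> v != Q -> s10 u v = s10 w v.
  by apply: async_sweep_rest_eq; rewrite ?s9T //; exact: s9eq.
clearbody s10.
rewrite [LHS]s5cat [RHS]s5cat [LHS]s6cat [RHS]s6cat [LHS]s7cat [RHS]s7cat.
rewrite [LHS]s8cat [RHS]s8cat [LHS]s9cat [RHS]s9cat [LHS]s10cat [RHS]s10cat /=.
have zeq : async f z (s10 x) (Ell ord0) = async f z (s10 y) (Ell ord0).
  by rewrite !async_eq !next_Ell0 (s10eq x y).
apply/ffunP => v; have [->|vQ] := eqVneq v Q.
  by rewrite !async_eq !next_Q !(@async_neq Q) // zeq.
have [->|vz] := eqVneq v z; first by rewrite !(@async_neq Q) // zeq.
by rewrite !(@async_neq Q) // !(@async_neq z) // (s10eq x y).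
Qed.

(** * A satisfying assignment from two fixed points *)

Lemma gate_cases o (a b t : bool) : gate o [:: a; b] = t -> a = t \/ b = t.
Proof. by case: o a b t => [] [] [] []; auto. Qed.

Lemma fixed_async_word w x : is_fixed f x -> async_word f w x = x.
Proof. by move=> fx; elim: w => //= v w; rewrite /async fx upd_id. Qed.

(** A sweep leaves a fixed point unchanged, and off [Q] its result depends only on [Ell ord0] and
    [T]. *)
Lemma fixed_eq x y : is_fixed f x -> is_fixed f y ->
  x (Ell ord0) = y (Ell ord0) -> x = y.
Proof.
move=> fx fy z0.
have Q0 : x Q = y Q by rewrite -fx -fy !next_Q z0.
have T0 : x T = y T.
  have [tau T_eq] := next_T; rewrite -fx -fy.
  by rewrite !(T_eq _).1 // -?[RHS]next_Q ?fx ?fy.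
apply/ffunP => v; have [-> //|vQ] := eqVneq v Q.
by rewrite -(fixed_async_word sweep fx) -(fixed_async_word sweep fy); apply: async_sweep_eq.
Qed.

Lemma fixed_Lit q l (fq : is_fixed f q) :
  exists o, q (Lit l) = gate o [:: q (Ell (lift ord_max l.1)); q T].
Proof.
have [o fE] := (BN_on_GarcP f).1 f_on (Lit l); exists o.
by rewrite -[in LHS]fq fE /signed_values /= !eqb_id.
Qed.

Lemma fixed_Ell q r (fq : is_fixed f q) :
  exists o, q (Ell (lift ord0 r)) = gate o [:: q (Lit (r, true)); q (Lit (r, false))].
Proof.
have [o fE] := (BN_on_GarcP f).1 f_on (Ell (lift ord0 r)); exists o.
by rewrite -[in LHS]fq fE /= liftK /signed_values /= !eqb_id.
Qed.

Lemma fixed_MuP q s (fq : is_fixed f q) :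
  exists o, q (MuP s) = gate o [:: q (Lit (cl s k0)); q (Lit (cl s k1))].
Proof.
have [o fE] := (BN_on_GarcP f).1 f_on (MuP s); exists o.
by rewrite -[in LHS]fq fE /signed_values /= !eqb_id.
Qed.

Lemma fixed_Mu q s (fq : is_fixed f q) :
  exists o, q (Mu s) = gate o [:: q (Lit (cl s k2)); q (MuP s)].
Proof.
have [o fE] := (BN_on_GarcP f).1 f_on (Mu s); exists o.
by rewrite -[in LHS]fq fE /signed_values /= !eqb_id.
Qed.

Section TwoFixedPoints.
Variables (tau : bool) (p p' : config vertex).
Hypotheses (p_fixed : is_fixed f p) (p'_fixed : is_fixed f p').
Hypotheses (pT : p T = tau) (p'T : p' T = tau).
Hypotheses (p0 : p (Ell ord0) = tau) (p'0 : p' (Ell ord0) = ~~ tau).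

(** At [C s] it matters that both fixed points share one gate. *)
Lemma fixed_gates v : exists o, p v = gate o (signed_values (inputs v) p) /\
                                p' v = gate o (signed_values (inputs v) p').
Proof.
have [o fE] := (BN_on_GarcP f).1 f_on v; exists o.
by rewrite -!fE p_fixed p'_fixed.
Qed.

(** Equal inputs pass through any gate, so [tau] spreads from [Ell ord0] and [T]. *)
Lemma p_Ell a : p (Ell a) = tau.
Proof.
elim: {a}(nat_of_ord a) {-2}a (erefl (nat_of_ord a)) => [|k IH] a ak.
  by rewrite -p0; congr (p (Ell _)); apply: val_inj.
case: (unliftP ord0 a) ak => [r ->|->//] /= []; rewrite add0n => rk.
have pl b : p (Lit (r, b)) = tau.
  have [o ->] := fixed_Lit (r, b) p_fixed.
  by rewrite pT IH ?gate_same //= -rk; exact: lift_max.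
by have [o ->] := fixed_Ell r p_fixed; rewrite !pl gate_same.
Qed.

Lemma p_Lit l : p (Lit l) = tau.
Proof. by have [o ->] := fixed_Lit l p_fixed; rewrite pT p_Ell gate_same. Qed.

Lemma p_Mu s : p (Mu s) = tau.
Proof.
have [o ->] := fixed_Mu s p_fixed; have [o' ->] := fixed_MuP s p_fixed.
by rewrite !p_Lit !gate_same.
Qed.

(** In [p] the negative arc contributes [~~ tau], so output [tau] forces the other input and the
    gate itself to be [tau]. Such a gate outputs [~~ tau] only if all its signed inputs are
    [~~ tau]. *)
Lemma C_next s : p (C s) = tau -> p' (C s) = ~~ tau ->
  [/\ p' (Mu s) = tau, p (next_clause s) = tau & p' (next_clause s) = ~~ tau].
Proof.
have [o [-> ->]] := fixed_gates (C s).
rewrite /signed_values /= p_Mu.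
case: (p (next_clause s)); case: (p' (next_clause s)); case: (p' (Mu s));
  by case: o; case: (tau).
Qed.

Lemma C_differ s : p (C s) = tau /\ p' (C s) = ~~ tau.
Proof.
elim: {s}(nat_of_ord s) {-2}s (erefl (nat_of_ord s)) => [|k IH] s sk.
  have -> : s = ord0 by apply: val_inj.
  by rewrite -!next_Ell0 p_fixed p'_fixed.
have ltk : k < m.+1 by rewrite -ltnS -sk ltnW // ltnS.
have [pk p'k] := IH (Ordinal ltk) erefl.
have [_] := C_next pk p'k.
suff -> : next_clause (Ordinal ltk) = C s by [].
rewrite /next_clause; case: unliftP => [s' /(congr1 val)|/(congr1 val)] /=.
  rewrite [bump _ _]lift_max => ks'; congr C; apply: val_inj.
  by rewrite /= /bump leq0n add1n -ks'.
by move=> km; have := ltn_ord s; rewrite sk km ltnn.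
Qed.

Lemma p'_Mu s : p' (Mu s) = tau.
Proof. by have [ps p's] := C_differ s; have [] := C_next ps p's. Qed.

Lemma p'_Ell_max : p' (Ell ord_max) = ~~ tau.
Proof.
have [ps p's] := C_differ ord_max; have [_ _] := C_next ps p's.
by rewrite /next_clause unlift_none.
Qed.

(** Were the earlier [Ell] equal to [tau], then with [T] it would give both literals, hence the
    later [Ell], that value. *)
Lemma p'_Ell_step r : p' (Ell (lift ord0 r)) = ~~ tau ->
  p' (Ell (lift ord_max r)) = ~~ tau /\
  ~ (p' (Lit (r, true)) = tau /\ p' (Lit (r, false)) = tau).
Proof.
move=> Er; have nboth : ~ (p' (Lit (r, true)) = tau /\ p' (Lit (r, false)) = tau).
  move=> [l1 l2]; have [o] := fixed_Ell r p'_fixed.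
  by rewrite Er l1 l2 gate_same; case: (tau).
split=> //; apply/eqP; apply: contra_notT nboth => Er'.
have Et : p' (Ell (lift ord_max r)) = tau.
  by move: Er'; case: (p' _); case: (tau).
have pl b : p' (Lit (r, b)) = tau.
  by have [o ->] := fixed_Lit (r, b) p'_fixed; rewrite p'T Et gate_same.
by rewrite !pl.
Qed.

Lemma p'_Ell a : p' (Ell a) = ~~ tau.
Proof.
have [k] := ubnP (n.+1 - a); elim: k a => // k IH a lek.
case: (unliftP ord_max a) lek => [r ->|-> _]; last exact: p'_Ell_max.
rewrite lift_max => lek; apply: (proj1 (p'_Ell_step (IH _ _))).
have r_lt : 0 < n.+1 - r by rewrite subn_gt0; exact: ltn_ord.
by rewrite /= /bump leq0n add1n subnS -ltnS prednK.
Qed.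

Lemma two_fixed_points_satisfiable : satisfiable cl.
Proof.
exists (fun r => p' (Lit (r, true)) == tau) => s.
(* A negative literal with value [tau] makes its variable false, as the two literals never share
   that value. *)
have sat l : p' (Lit l) = tau -> lit_sat (fun r => p' (Lit (r, true)) == tau) l.
  case: l => r [] /= pl; rewrite /lit_sat /= ?pl ?eqxx //.
  have [_ nboth] := p'_Ell_step (p'_Ell (lift ord0 r)).
  by apply/eqP/eqP => pl'; apply: nboth.
have [o] := fixed_Mu s p'_fixed; rewrite p'_Mu => /esym /gate_cases [l2|].
  by exists k2; apply: sat.
have [o' ->] := fixed_MuP s p'_fixed => /gate_cases [] lk.
  by exists k0; apply: sat.
by exists k1; apply: sat.
Qed.

End TwoFixedPoints.

Lemma unsatisfiable_fixed_unique x y :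
  ~ satisfiable cl -> is_fixed f x -> is_fixed f y -> x = y.
Proof.
move=> unsat fx fy; apply: (fixed_eq fx fy).
have [tau T_eq] := next_T.
have fT u (fu : is_fixed f u) : u T = tau.
  by rewrite -fu (T_eq u).1 // -next_Q fu.
have [xt|xt] := eqVneq (x (Ell ord0)) tau; have [yt|yt] := eqVneq (y (Ell ord0)) tau.
- by rewrite xt yt.
- case: unsat; apply: (two_fixed_points_satisfiable fx fy (fT _ fx) (fT _ fy) xt).
  by move: yt; case: (y _); case: (tau).
- case: unsat; apply: (two_fixed_points_satisfiable fy fx (fT _ fy) (fT _ fx) yt).
  by move: xt; case: (x _); case: (tau).
by move: xt yt; case: (x _); case: (y _); case: (tau).
Qed.

End Network.

End Inputs.

(** * The equivalence *)

Theorem theorem6 (n m : nat) (cl : 'I_m -> 'I_3 -> literal n) :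
  2 <= n -> 1 <= m ->
  (forall s : 'I_m, injective (cl s)) ->
  [<-> ~ satisfiable cl;
       forall f : BN (vert n m), BN_on (Garc cl) f ->
         forall x y, is_fixed f x -> is_fixed f y -> x = y;
       exists w : seq (vert n m), size w = 12 * n + 12 * m + 11 /\
         forall f : BN (vert n m), BN_on (Garc cl) f -> synchronizes w f;
       forall f : BN (vert n m), BN_on (Garc cl) f -> synchronizing f].
Proof.
case: n m cl => [//|n'] [//|m'] {}cl _ _ cl_inj.
split; [|split; [|split]].
- by move=> unsat f f_on x y; apply: (unsatisfiable_fixed_unique cl_inj f_on unsat).
- move=> uniq_fixed; pose z : vert n'.+1 m'.+1 := Ell ord0.
  exists ([:: Q; T] ++ sweep n' m' ++ [:: z; Q] ++ sweep n' m' ++ [:: z] ++ sweep n' m' ++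
    [:: T; z] ++ sweep_start n' m' ++ [:: T] ++ sweep_rest n' m' ++ [:: z; Q; Q]); split.
    (* Three whole sweeps and a split one have 3n + 3m letters each; the other letters number 2 + 2
       + 1 + 2 + 1 + 3 = 11. *)
    rewrite !size_cat size_sweep_rest /=; lia.
  move=> f f_on; apply: (sweep_synchronizing_word cl_inj f_on) => x y.
  exact: uniq_fixed.
- by case=> w [_ ws] f f_on; exists w; apply: ws.
(* Every word leaves both fixed points unchanged, so none can merge them. *)
move=> sync /satisfiable_two_fixed_points [] // f [f_on [x [y [fx fy]]]]; case.
have [w /(_ x y)] := sync f f_on.
by rewrite !fixed_async_word.
Qed.
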